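(* Let $\mathbf{A}=\mathbf{ZD}$ or $\mathbf{A}=\mathbf{ZD_0}$. Let $\mathbf{C}$ be a coreflective subcategory of $\mathbf{A}$ (respectively, an AD-class in $\mathbf{A}$) such that $\mathbf{C}\not\subseteq\mathbf{FG}\cap\mathbf{A}$, and let $\alpha$ be the smallest cardinal such that there exist a space $X\in\mathbf{C}$ and a system $U_\beta$, $\beta<\alpha$, of open sets in $X$ whose intersection $\bigcap_{\beta<\alpha}U_\beta$ is not open. Then $\alpha$ is a regular cardinal and $\mathrm{CH}_{\mathbf{A}}(C(\alpha))\subseteq\mathbf{C}$ (respectively, $\mathrm{AD}_{\mathbf{A}}(C(\alpha))\subseteq\mathbf{C}$).
   Context: All subcategories of the category $\mathbf{Top}$ of topological spaces are full and isomorphism-closed, and every subcategory is assumed to contain at least one space with at least two points. $\mathbf{ZD}$ is the category of zero-dimensional spaces (spaces having a base of clopen sets; no separation axiom is assumed), and $\mathbf{ZD_0}$ is the category of zero-dimensional $T_0$-spaces. $\mathbf{FG}$ is the class of finitely generated spaces, i.e. spaces in which every intersection of open sets is open. A subcategory $\mathbf{C}\subseteq\mathbf{A}$ is coreflective in $\mathbf{A}$ if every object of $\mathbf{A}$ has a $\mathbf{C}$-coreflection; equivalently (for these $\mathbf{A}$), $\mathbf{C}$ is closed under topological sums and under codomains of $\mathbf{A}$-extremal epimorphisms. $\mathbf{C}\subseteq\mathbf{A}$ is an AD-class in $\mathbf{A}$ if it is closed under topological sums and whenever $q\colon X\to Y$ is a quotient map with $X\in\mathbf{C}$ and $Y\in\mathbf{A}$,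 then $Y\in\mathbf{C}$. For a space $B\in\mathbf{A}$, $\mathrm{CH}_{\mathbf{A}}(B)$ is the smallest coreflective subcategory of $\mathbf{A}$ containing $B$, and $\mathrm{AD}_{\mathbf{A}}(B)$ is the smallest AD-class in $\mathbf{A}$ containing $B$. Ordinals are identified with the sets of their predecessors and cardinals with initial ordinals. For an infinite cardinal $\alpha$, $C(\alpha)$ is the space on the set $\alpha\cup\{\alpha\}$ in which each $\beta\in\alpha$ is isolated and the sets $B_\beta=\{\xi\in\alpha\cup\{\alpha\}:\xi\ge\beta\}$, $\beta<\alpha$, form a local base at $\alpha$. Regular cardinals are understood to be infinite. *)

(* Defs.v *)
From HB Require Import structures.
From mathcomp Require Import all_boot all_order.
From mathcomp Require Import all_classical wochoice.
From mathcomp Require Import topology.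

Set Implicit Arguments.
Unset Strict Implicit.
Unset Printing Implicit Defensive.

Local Open Scope classical_set_scope.
Local Open Scope card_scope.

(* A full subcategory of Top, given by its class of objects; the spaces
   range over [topologicalType], so the empty space is included. *)
Definition spaceClass := topologicalType -> Prop.

Definition subclass (C D : spaceClass) : Prop := forall X, C X -> D X.

Definition classI (C D : spaceClass) : spaceClass := fun X => C X /\ D X.

Definition homeomorphic (X Y : topologicalType) : Prop :=
  exists (f : X -> Y) (g : Y -> X),
    [/\ continuous f, continuous g, cancel f g & cancel g f].

Definition is_quotient_map (X Y : topologicalType) (q : X -> Y) : Prop :=
  [/\ continuous q, (forall y, exists x, q x = y)
    & forall U : set Y, open (q @^-1` U) -> open U].

(* Not [separation_axioms.zero_dimensional], which only asks that distinct
   points be separated by clopen sets. *)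
Definition ZD : spaceClass := fun X =>
  exists2 B : set (set X), basis B & B `<=` clopen.

Definition ZD0 : spaceClass := fun X => ZD X /\ kolmogorov_space X.

Definition FG : spaceClass := fun X =>
  forall F : set (set X), F `<=` open -> open (\bigcap_(U in F) U).

Record subcategory (A C : spaceClass) : Prop := Subcategory {
  subcategory_sub : subclass C A;
  subcategory_homeo : forall X Y, homeomorphic X Y -> C X -> C Y;
  subcategory_two : exists X : topologicalType,
    C X /\ exists x y : X, x <> y }.

Definition is_coreflection (C : spaceClass) (X Z : topologicalType)
    (c : Z -> X) : Prop :=
  [/\ C Z, continuous c
    & forall (Y : topologicalType) (f : Y -> X), C Y -> continuous f ->
        exists! g : Y -> Z, continuous g /\ c \o g = f].

Definition coreflective (A C : spaceClass) : Prop :=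
  subcategory A C /\
  forall X, A X ->
    exists (Z : topologicalType) (c : Z -> X), is_coreflection C c.

(* [{i & X i}] carries the topology of the disjoint sum. *)
Definition sum_closed (C : spaceClass) : Prop :=
  forall (I : choiceType) (X : I -> topologicalType),
    (forall i, C (X i)) -> C {i & X i}.

Definition AD_class (A C : spaceClass) : Prop :=
  [/\ subcategory A C, sum_closed C
    & forall (X Y : topologicalType) (q : X -> Y),
        is_quotient_map q -> C X -> A Y -> C Y].

(* CH and AD are the intersections of all coreflective subcategories, resp.
   AD-classes, of A containing B. For the A considered here, both notions are
   given by closure conditions, so these intersections are the smallest ones. *)
Definition CH (A : spaceClass) (B : topologicalType) : spaceClass :=
  fun X => forall D, coreflective A D -> D B -> D X.

Definition AD (A : spaceClass) (B : topologicalType) : spaceClass :=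
  fun X => forall D, AD_class A D -> D B -> D X.

(* Initial ordinals: well-ordered types that do not inject into any of their
   proper initial segments [{y | y < x}].  Finite ones are allowed. *)
Record cardinal := Cardinal {
  cset :> Type;
  cle : rel cset;
  cle_wo : well_order cle;
  cle_initial : forall x, ~ ([set: cset] #<= [set y | ~~ cle x y]) }.

Section cardinal_order.
Variable a : cardinal.
Implicit Types x y z : a.

Lemma cle_min (P : a -> Prop) : (exists x, P x) ->
  exists! z, P z /\ forall x, P x -> cle z x.
Proof.
move=> [x Px]; have [|z [[/asboolP Pz zmin] zuniq]] := @cle_wo a [pred x | `[< P x >]].
  by exists x; apply/asboolP.
exists z; split=> [|w [Pw wmin]].
  by split=> // y Py; apply: zmin; apply/asboolP.
by apply: zuniq; split=> [|y /asboolP]; [exact/asboolP|exact: wmin].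
Qed.

Lemma cle_total x y : cle x y \/ cle y x.
Proof.
have [|z [[[]-> zmin] _]] := @cle_min (fun z => z = x \/ z = y).
- by exists x; left.
- by left; apply: zmin; right.
- by right; apply: zmin; left.
Qed.

Lemma cle_refl x : cle x x.
Proof. by case: (cle_total x x). Qed.

Lemma cle_anti x y : cle x y -> cle y x -> x = y.
Proof.
move=> xy yx.
have [|z [_ zuniq]] := @cle_min (fun z => z = x \/ z = y); first by exists x; left.
rewrite -(zuniq x); last by split=> [|w []->//]; [left|exact: cle_refl].
by apply: zuniq; split=> [|w []->//]; [right|exact: cle_refl].
Qed.

Lemma cle_trans y x z : cle x y -> cle y z -> cle x z.
Proof.
move=> xy yz.
have [|w [[wP wmin] _]] := @cle_min (fun w => [\/ w = x, w = y | w = z]).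
  by exists x; constructor.
have wx : cle w x by apply: wmin; constructor.
have wy : cle w y by apply: wmin; constructor.
have wz : cle w z by apply: wmin; constructor.
case: wP wx wy wz => -> // wx wy wz; first by rewrite (cle_anti xy wx).
by rewrite -(cle_anti yz wy).
Qed.

End cardinal_order.

Definition infinite_cardinal (a : cardinal) : Prop := infinite_set [set: a].

Definition cofinal (a : cardinal) (S : set a) : Prop :=
  forall x, exists2 y, S y & cle x y.

Definition regular_cardinal (a : cardinal) : Prop :=
  infinite_cardinal a /\
  forall S : set a, cofinal S -> [set: a] #<= S.

(* The space C(a); [Some b] is the ordinal [b < a] and [None] is the point [a].
   The proof that [a] is infinite is only used to know that the sets
   [C_tail b] form a filter base. *)
Definition C_space (a : cardinal) (ainf : infinite_cardinal a) : Type :=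
  option a.

Section C_space_topology.
Variables (a : cardinal) (ainf : infinite_cardinal a).

Definition C_tail (b : a) : set (C_space ainf) :=
  [set x | if x is Some y then cle b y else True].

Definition C_nbhs (x : C_space ainf) : set_system (C_space ainf) :=
  if x is Some _ then principal_filter x else filter_from setT C_tail.

HB.instance Definition _ := gen_eqMixin (C_space ainf).
HB.instance Definition _ := gen_choiceMixin (C_space ainf).
HB.instance Definition _ := hasNbhs.Build (C_space ainf) C_nbhs.

Local Lemma C_tail_meet (b c : a) :
  exists d, C_tail d `<=` C_tail b `&` C_tail c.
Proof.
have [bc|cb] := cle_total b c.
- by exists c => -[y|] //= cy; split=> //; exact: cle_trans cy.
- by exists b => -[y|] //= cy; split=> //; exact: cle_trans cy.
Qed.

Local Lemma C_nbhs_proper (x : C_space ainf) : ProperFilter (C_nbhs x).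
Proof.
case: x => [b|] /=; first exact: principal_filter_proper.
apply: filter_from_proper; last by move=> b _; exists None.
apply: filter_from_filter; first exact: infinite_setN0 ainf.
by move=> b c _ _; have [d] := C_tail_meet b c; exists d.
Qed.

Local Lemma C_nbhs_singleton (x : C_space ainf) (P : set (C_space ainf)) :
  C_nbhs x P -> P x.
Proof. by case: x => [b /principal_filterP|[b _]]; last exact. Qed.

Local Lemma C_nbhs_nbhs (x : C_space ainf) (P : set (C_space ainf)) :
  C_nbhs x P -> C_nbhs x (C_nbhs^~ P).
Proof.
case: x => [b /principal_filterP Pb|[b _ bP]].
  exact/principal_filterP/principal_filterP.
exists b => // -[y|] /= by_; last by exists b.
exact/principal_filterP/bP.
Qed.

HB.instance Definition _ := Nbhs_isNbhsTopological.Build (C_space ainf)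
  C_nbhs_proper C_nbhs_singleton C_nbhs_nbhs.

End C_space_topology.

Definition has_nonopen_bigcap (C : spaceClass) (a : cardinal) : Prop :=
  exists X : topologicalType, C X /\
  exists U : a -> set X,
    (forall b, open (U b)) /\ ~ open (\bigcap_(b in [set: a]) U b).

Definition least_nonopen_bigcap (C : spaceClass) (a : cardinal) : Prop :=
  has_nonopen_bigcap C a /\
  forall b : cardinal, has_nonopen_bigcap C b -> [set: a] #<= [set: b].

(* Main.v *)
(* Let X in C have an a-indexed family of open sets with non-open intersection.
   By minimality of a, intersections of fewer than a open sets of X are open.
   Cutting the family along a cofinal set of size < a would thus make the
   intersection open, so a is regular.  Shrinking around a bad point x gives a
   decreasing tower of clopen neighbourhoods of x whose intersection is not a
   neighbourhood of x.  Mapping each point to the level at which it leaves the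
   tower, rounded up to a prescribed cofinal set of levels, gives enough
   continuous maps X -> C(a) to determine the topology of C(a).  Hence C(a) is
   a quotient of a sum of copies of X, and its C-coreflection is a
   homeomorphism. *)
Require Import Defs.
From mathcomp Require Import all_boot all_order.
From mathcomp Require Import all_classical wochoice.
From mathcomp Require Import topology.

Set Implicit Arguments.
Unset Strict Implicit.
Unset Printing Implicit Defensive.

Local Open Scope classical_set_scope.
Local Open Scope card_scope.

(** * Initial ordinals of arbitrary types *)

Lemma injective_card_le (T U : Type) (S : set T) (S' : set U) (f : T -> U) :
  injective f -> (forall x, S x -> S' (f x)) -> S #<= S'.
Proof.
move=> finj fS; have [|g] := (@injfunPex T U S S').2; last exact: inj_card_le.
by exists f => // x y _ _; exact: finj.
Qed.

(** Well-order [T] and keep the least initial segment [D] into which [T] still injects, or all of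
    [T] if no proper one exists. Minimality makes the order on [D] an initial ordinal. *)
Lemma cardinal_of_type (T : Type) : exists (b : cardinal) (e : b -> T),
  [set: b] #<= [set: T] /\ forall t, exists x, e x = t.
Proof.
have [R Rwo] := well_ordering_principle {classic T}.
have Rmin (P : set T) : P !=set0 -> exists2 z, P z & forall x, P x -> R z x.
  move=> [x Px]; have [|z [[/asboolP Pz zmin] _]] := Rwo [pred x | `[< P x >]].
    by exists x; apply/asboolP.
  by exists z => // y Py; apply: zmin; apply/asboolP.
have [D TD Dmin] : exists2 D : set T, [set: T] #<= D &
    forall x, D x -> ~ ([set: T] #<= [set y | D y /\ ~~ R x y]).
  have [big|small] :=
    pselect ([set x | [set: T] #<= [set y : T | ~~ R x y]] !=set0); last first.
    exists setT => // x _ xbig; apply: small; exists x.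
    by apply: card_le_trans xbig _; apply: subset_card_le => y [].
  have [z zbig zmin] := Rmin _ big; exists [set y | ~~ R z y] => // x xz.
  move=> xbig; have : [set: T] #<= [set y : T | ~~ R x y].
    by apply: card_le_trans xbig _; apply: subset_card_le => y [].
  by move=> /zmin zx; rewrite /= zx in xz.
pose RD : rel (set_type D) := fun x y => R (val x) (val y).
have RDwo : well_order RD.
  move=> P [x Px].
  have [|z [[/asboolP[w [Pw wz]] zmin] zuniq]] :=
      Rwo [pred t | `[< exists w, w \in P /\ val w = t >]].
    by exists (val x); apply/asboolP; exists x.
  exists w; split=> [|v [Pv vmin]].
    by split=> // v Pv; rewrite /RD wz; apply: zmin; apply/asboolP; exists v.
  apply: val_inj; rewrite wz; apply: zuniq; split.
    by apply/asboolP; exists v.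
  by move=> t /asboolP[u [Pu <-]]; exact: vmin.
have RDinit (x : set_type D) :
    ~ ([set: set_type D] #<= [set y | ~~ RD x y]).
  move=> Dx; apply: (Dmin (val x)); first exact: set_valP.
  apply: card_le_trans TD _; apply: card_le_trans (card_le_trans _ Dx) _.
    by apply/card_leP; squash (to_setT).
  apply: (@injective_card_le _ _ _ _ val) => [|y /= xy]; first exact: val_inj.
  by split=> //; exact: set_valP.
exists (Cardinal RDwo RDinit).
have DT : D #= [set: T] by apply/card_eqPle; split=> //; exact: card_leT.
have /card_bijP[f [g fK gK]] := DT.
exists (fun x => val (f x)); split.
  by apply: (@injective_card_le _ _ _ _ val) => //; exact: val_inj.
by move=> t; exists (g (to_setT t)); rewrite gK.
Qed.

(** * Regularity, the clopen tower and maps into C(a) *)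

Section least_bigcap.
Variables (X : topologicalType) (a : cardinal) (U : a -> set X).
Hypothesis Uopen : forall b, open (U b).
Hypothesis UNopen : ~ open (\bigcap_(b in [set: a]) U b).
Hypothesis small_open : forall (T : Type) (S : set T) (V : T -> set X),
  (forall t, open (V t)) -> ~ ([set: a] #<= S) ->
  open (\bigcap_(t in S) V t).

Lemma least_bigcap_infinite : infinite_cardinal a.
Proof.
move=> /(@finite_fsetP {classic a})[F aF]; apply: UNopen; rewrite openE => x Ux.
rewrite /interior [X in bigcap X]aF.
apply: (@filter_bigI X {classic a}) => b _; apply: open_nbhs_nbhs.
by split=> //; exact: Ux.
Qed.

(** If [b] were the maximum, the intersection would be [U b] cut with the family below [b], which is
    indexed by a proper initial segment and hence by fewer than [a] elements. *)
Lemma least_bigcap_nomax (b : a) : exists c, ~~ cle c b.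
Proof.
apply: contrapT => bmax; have {}bmax c : cle c b.
  by apply: contrapT => /negP cb; apply: bmax; exists c.
apply: UNopen.
have -> : \bigcap_(c in [set: a]) U c =
    \bigcap_(c in [set c | ~~ cle b c]) U c `&` U b.
  apply/seteqP; split=> [x Ux|x [Ux Ub] c _]; first by split=> [c _|]; exact: Ux.
  have [bc|/Ux//] := boolP (cle b c).
  by rewrite (cle_anti (bmax c) bc).
by apply: openI => //; apply: small_open => //; exact: cle_initial.
Qed.

(** Regrouping over strict initial segments keeps every inner intersection small. No index is lost:
    without a maximum, each [c] lies strictly below some element of [S]. *)
Lemma bigcap_initial_cofinal (V : a -> set X) (S : set a) : cofinal S ->
  \bigcap_(s in S) \bigcap_(c in [set c | ~~ cle s c]) V c =
  \bigcap_(c in [set: a]) V c.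
Proof.
move=> Scof; apply/seteqP; split=> [x Vx c _|x Vx s _ c _]; last exact: Vx.
have [d dc] := least_bigcap_nomax c; have [s Ss ds] := Scof d.
by apply: (Vx s) => //=; apply: contra dc; exact: cle_trans.
Qed.

Lemma least_bigcap_regular : regular_cardinal a.
Proof.
split=> [|S Scof]; first exact: least_bigcap_infinite.
apply: contrapT => Ssmall; apply: UNopen.
rewrite -(bigcap_initial_cofinal U Scof); apply: small_open => // s.
by apply: small_open => //; exact: cle_initial.
Qed.

Lemma clopen_tower : ZD X -> exists (x : X) (W : a -> set X),
  [/\ forall b, clopen (W b), forall b c, cle b c -> W c `<=` W b,
      forall b, W b x & ~ nbhs x (\bigcap_(b in [set: a]) W b)].
Proof.
move=> [B [Bopen Bnbhs] Bclopen].
have [x [Ux xN]] : exists x, (\bigcap_(b in [set: a]) U b) x /\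
    ~ nbhs x (\bigcap_(b in [set: a]) U b).
  apply: contrapT => noX; apply: UNopen; rewrite openE => x Ux.
  by apply: contrapT => xN; apply: noX; exists x.
have /choice[G GP] b : exists G, [/\ B G, G x & G `<=` U b].
  have [|G [BG Gx] GU] := Bnbhs x (U b); last by exists G.
  by apply: open_nbhs_nbhs; split=> //; exact: Ux.
have Gclopen b : clopen (G b) by apply: Bclopen; case: (GP b).
(* Only indices strictly below [b] are used, so fewer than [a] clopen sets meet and the result is
   still open. *)
exists x, (fun b => \bigcap_(c in [set c | ~~ cle b c]) G c); split.
- move=> b; split; last by apply: closed_bigI => c _; case: (Gclopen c).
  by apply: small_open; [move=> c; case: (Gclopen c)|exact: cle_initial].
- move=> b c bc y Wy d /= bd; apply: Wy => /=.
  by apply: contra bd; exact: cle_trans.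
- by move=> b c _; case: (GP c).
- rewrite bigcap_initial_cofinal; last by move=> b; exists b => //; exact: cle_refl.
  move=> xW; apply: xN; apply: filterS xW => y Gy b _.
  by case: (GP b) => _ _; apply; exact: Gy.
Qed.

(* The map sends [y] to the least [b] in the complement of [O] such that [y]
   lies outside the [b]-th set of the tower; that complement is cofinal, so
   exactly the intersection of the tower is mapped into [O]. *)
Lemma detecting_map (ainf : infinite_cardinal a) (O : set (C_space ainf)) :
  ZD X -> O None -> ~ nbhs (None : C_space ainf) O ->
  exists2 h : X -> C_space ainf, continuous h & ~ open (h @^-1` O).
Proof.
move=> /clopen_tower[x [W [Wclopen Wdecr Wx WN]]] ONone ON.
pose S : set a := [set b | ~ O (Some b)].
have Scof : cofinal S.
  move=> b; apply: contrapT => noS; apply: ON; exists b => // -[c|//] /= bc.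
  by apply: contrapT => Oc; apply: noS; exists c.
have /choice[h hP] y : exists v : C_space ainf,
    if v is Some b then [/\ S b, ~ W b y & forall c, S c -> ~ W c y -> cle b c]
    else forall b, W b y.
  have [Wy|] := pselect (forall b, W b y); first by exists None.
  move=> /existsNP[b Wb]; have [c Sc bc] := Scof b.
  have [|d [[[Sd Wd] dmin] _]] := @cle_min a (fun d => S d /\ ~ W d y).
    by exists c; split=> // /(Wdecr _ _ bc).
  by exists (Some d); split=> // e Se We; exact: dmin.
exists h; last first.
  rewrite openE => /(_ x); rewrite /interior => hx; apply: WN.
  have hxN : h x = None by case: (h x) (hP x) => [b []|].
  have := hx _; rewrite /preimage /= hxN => /(_ ONone); apply: filterS => y Oy b _.
  by move: (hP y) Oy; rewrite /=; case: (h y) => [c []//|Wy _]; exact: Wy.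
move=> y; have := hP y; case hy: (h y) => [b|].
  move=> [Sb Wb bmin] P; rewrite hy => /principal_filterP Pb.
  rewrite /nbhs /=.
  (* This set is the fibre of [h] over [Some b]: its points lie in [W c] for all earlier [c] in [S]
     and leave at [b]. It is open because the indices [c] are taken below [b]. *)
  have fiber : nbhs y
      (\bigcap_(c in [set c | ~~ cle b c /\ S c]) W c `&` ~` W b).
    apply: open_nbhs_nbhs; split.
      apply: openI; last by apply: closed_openC; case: (Wclopen b).
      apply: small_open => [c|]; first by case: (Wclopen c).
      move=> big; apply: (@cle_initial a b); apply: card_le_trans big _.
      by apply: subset_card_le => c [].
    split=> // c [bc Sc]; apply: contrapT => Wc; move/negP: bc; apply.
    exact: bmin.
  apply: filterS fiber => z [Wz Wbz] /=.
  have := hP z; rewrite /preimage /=.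
  case: (h z) => [c [Sc Wcz cmin]|Wz']; last by case: Wbz; exact: Wz'.
  suff -> : c = b by [].
  apply: cle_anti; first exact: cmin.
  by apply: contrapT => /negP bc; apply: Wcz; exact: Wz.
move=> Wy P; rewrite hy => -[b _ bP]; rewrite /nbhs /=.
(* The tower decreases, so a point of [W b] can leave only after [b], and [h] sends [W b] into the
   tail at [b]. *)
have Wb : nbhs y (W b).
  by apply: open_nbhs_nbhs; split=> //; case: (Wclopen b).
apply: filterS Wb => z Wz; apply: bP; rewrite /C_tail /=.
have := hP z; case: (h z) => [c [Sc Wcz _]|//].
have [//|cb] := cle_total b c.
by case: Wcz; exact: Wdecr Wz.
Qed.

End least_bigcap.

(** Minimality of [a] speaks of initial ordinals only; an arbitrary index set [S] is reindexed by a
    surjection from an initial ordinal no larger than [S]. *)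
Lemma least_nonopen_bigcap_small (C : spaceClass) (a : cardinal)
    (X : topologicalType) (T : Type) (S : set T) (V : T -> set X) :
  least_nonopen_bigcap C a -> C X -> (forall t, open (V t)) ->
  ~ ([set: a] #<= S) -> open (\bigcap_(t in S) V t).
Proof.
move=> [_ amin] CX Vopen Ssmall; apply: contrapT => VN; apply: Ssmall.
have [b [e [bS eS]]] := cardinal_of_type (set_type S).
have : [set: a] #<= [set: b].
  apply: amin; exists X; split=> //; exists (fun x => V (val (e x))).
  split=> //; suff -> : \bigcap_(x in [set: b]) V (val (e x)) =
      \bigcap_(t in S) V t by [].
  apply/seteqP; split=> [x Vx t St|x Vx z _]; last by apply: Vx; exact: set_valP.
  by have [z ez] := eS (SigSub (mem_set St)); have := Vx z I; rewrite ez.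
move=> ab; apply: card_le_trans ab (card_le_trans bS _).
apply: (@injective_card_le _ _ _ _ val) => [|y _]; first exact: val_inj.
exact: set_valP.
Qed.

(** * Separation properties of C(a) *)

Section C_space_class.
Variables (a : cardinal) (ainf : infinite_cardinal a).
Local Notation Ca := (C_space ainf).

Lemma C_space_open (O : set Ca) :
  (O None -> nbhs (None : Ca) O) -> open O.
Proof.
by move=> ON; rewrite openE => -[b Ob|/ON//]; exact/principal_filterP.
Qed.

Lemma C_tail_clopen (b : a) : clopen (C_tail b : set Ca).
Proof.
split; first by apply: C_space_open => _; exists b.
by rewrite -openC; apply: C_space_open => /(_ I).
Qed.

Hypothesis nomax : forall b : a, exists c, ~~ cle c b.

Lemma C_point_clopen (b : a) : clopen [set Some b : Ca].
Proof.
split; first exact: C_space_open.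
(* A tail starting strictly above [b] is a neighbourhood of [None] that misses [Some b]. *)
rewrite -openC; apply: C_space_open => _; have [c cb] := nomax b.
by exists c => // -[d|//] /= cd [db]; rewrite db (negbTE cb) in cd.
Qed.

Lemma C_space_ZD : ZD Ca.
Proof.
exists clopen => //; split=> [V []//|x V].
case: x => [b /principal_filterP Vb|[b _ bV]].
  exists [set Some b]; first by split=> //; exact: C_point_clopen.
  by move=> _ ->.
by exists (C_tail b) => //; split=> //; exact: C_tail_clopen.
Qed.

Lemma C_space_kolmogorov : kolmogorov_space Ca.
Proof.
have nbhs_point (b : a) (y : Ca) : (Some b : Ca) != y ->
    [set Some b : Ca] \in nbhs (Some b : Ca) /\ y \in ~` [set Some b : Ca].
  move=> by_; split; apply/mem_set; first exact/principal_filterP.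
  by move=> /= yb; rewrite yb eqxx in by_.
move=> [b|] y xy; first by exists [set Some b]; left; exact: nbhs_point.
case: y xy => [b|/eqP/(_ erefl)[]] bN; exists [set Some b]; right.
by apply: nbhs_point; rewrite eq_sym.
Qed.

Lemma C_space_ZD_ZD0 (A : spaceClass) : A = ZD \/ A = ZD0 -> A Ca.
Proof.
by move=> [->|->]; [|split]; [exact: C_space_ZD..|exact: C_space_kolmogorov].
Qed.

End C_space_class.

(** * Membership of a space detected by maps from [X] *)

(** Says that [Y] has the final topology for all continuous maps from [X]. *)
Definition detects (X Y : topologicalType) : Prop := forall O : set Y,
  (forall h : X -> Y, continuous h -> open (h @^-1` O)) -> open O.

(** Take one copy of [X] for each continuous map to [Y] and apply that map on its copy. Constant
    maps give surjectivity, detection gives the quotient topology. *)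
Lemma AD_class_detects (A C : spaceClass) (X Y : topologicalType) (x : X) :
  AD_class A C -> C X -> A Y -> detects X Y -> C Y.
Proof.
move=> [_ Csum Cquot] CX AY XY.
pose I : choiceType := {classic {h : X -> Y | continuous h}}.
pose q (u : {i : I & X}) : Y :=
  sval (projT1 u : {h : X -> Y | continuous h}) (projT2 u).
apply: (Cquot _ _ q _ (Csum I (fun=> X) (fun=> CX)) AY); split.
- apply: (@sigT_continuous I (fun=> X) Y (fun i => sval i)) => i.
  exact: (svalP i).
- move=> y; have yc : continuous (fun _ : X => y) by move=> z; exact: cvg_cst.
  by exists (existT _ (exist _ _ yc) x).
- move=> O /sigT_openP Oq; apply: XY => h hc.
  exact: (Oq (exist _ h hc)).
Qed.

(** Lifting constant maps from the nonempty [X] makes [c] surjective, and uniqueness of the lifts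
    makes it injective. Its inverse [k] is continuous because [k \o h] is the continuous lift of
    [h], for each [h] from [X]. *)
Lemma coreflection_detects_homeo (C : spaceClass) (X Y Z : topologicalType)
    (x : X) (c : Z -> Y) :
  C X -> is_coreflection C c -> detects X Y -> homeomorphic Z Y.
Proof.
move=> CX [CZ cc cuniv] XY.
have csurj y : exists z, c z = y.
  have [|g [[_ cg] _]] := cuniv X (fun=> y) CX; first by move=> z; exact: cvg_cst.
  by exists (g x); rewrite -[c (g x)]/((c \o g) x) cg.
have cinj : injective c.
  move=> z z' zz'.
  have [|g [_ guniq]] := cuniv X (fun=> c z) CX; first by move=> t; exact: cvg_cst.
  have gz : g = fun=> z by apply: guniq; split=> // t; exact: cvg_cst.
  have gz' : g = fun=> z'.
    by apply: guniq; split=> [t|]; [exact: cvg_cst|apply/funext => t /=].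
  by rewrite -[z]/((fun=> z) x) -gz gz'.
have /choice[k kK] := csurj.
exists c, k; split=> //; last by move=> z; apply: cinj; rewrite kK.
apply/continuousP => V Vopen; apply: XY => h hc.
have [g [[gc cg] _]] := cuniv X h CX hc.
have -> : h @^-1` (k @^-1` V) = g @^-1` V.
  apply/seteqP; rewrite -cg; split=> t /=; have -> : k (c (g t)) = g t;
    by [apply: cinj; rewrite kK|].
by move/continuousP: gc; exact.
Qed.

Theorem theorem6p12 (A : spaceClass) (hA : A = ZD \/ A = ZD0)
    (C : spaceClass) (hC : ~ subclass C (classI FG A))
    (a : cardinal) (ha : least_nonopen_bigcap C a) :
  (coreflective A C ->
     regular_cardinal a /\
     forall ainf : infinite_cardinal a, subclass (CH A (C_space ainf)) C) /\
  (AD_class A C ->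
     regular_cardinal a /\
     forall ainf : infinite_cardinal a, subclass (AD A (C_space ainf)) C).
Proof.
have [[X [CX [U [Uopen UN]]]] _] := ha.
have small T (S : set T) (V : T -> set X) :=
  @least_nonopen_bigcap_small C a X T S V ha CX.
have areg := least_bigcap_regular Uopen UN small.
(* In an empty space every set is open, so the non-open intersection forces a point. *)
have [x _] : exists x : X, True.
  apply: contrapT => X0; apply: UN; rewrite openE => x _.
  by case: X0; exists x.
have nomax := least_bigcap_nomax Uopen UN small.
have ACa (ainf : infinite_cardinal a) : A (C_space ainf).
  exact: C_space_ZD_ZD0.
have XCa (ainf : infinite_cardinal a) : subcategory A C -> detects X (C_space ainf).
  move=> Csub O Oh; apply: C_space_open => ON; apply: contrapT => NO.
  have XZD : ZD X by have := subcategory_sub Csub CX; case: hA => ->; [|case].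
  have [h hc []] := detecting_map Uopen UN small XZD ON NO.
  exact: Oh.
(* [Y] lies in every admissible class containing C(a), so it remains to put C(a) itself in [C]. *)
split=> CA; split=> // ainf Y; apply=> //.
  have [Csub coref] := CA; have [Z [c cZ]] := coref _ (ACa ainf).
  have [CZ _ _] := cZ.
  apply: (subcategory_homeo Csub) CZ.
  exact: coreflection_detects_homeo x _ CX cZ (XCa _ Csub).
have [Csub _ _] := CA.
exact: AD_class_detects x CA CX (ACa ainf) (XCa _ Csub).
Qed.
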